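(* Let $K$ be a compact abelian group and let $G$ be a subgroup of $K$. If $K$ is torsion-free, then $G$ is locally minimal if and only if it is minimal.
   Context: Compact groups are Hausdorff; $G$ carries the subspace topology. A Hausdorff topological group $(G,\tau)$ is minimal if there is no Hausdorff group topology on $G$ strictly coarser than $\tau$; it is locally minimal if there exists a neighborhood $V$ of $0$ such that whenever $\sigma\subseteq\tau$ is a Hausdorff group topology on $G$ for which $V$ is a $\sigma$-neighborhood of $0$, then $\sigma=\tau$. *)

(* Defs.v *)
From HB Require Import structures.
From mathcomp Require Import all_boot all_order all_algebra.
From mathcomp Require Import all_classical topology tvs.

Set Implicit Arguments.
Unset Strict Implicit.
Unset Printing Implicit Defensive.

Import GRing.Theory.
Local Open Scope classical_set_scope.
Local Open Scope ring_scope.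

(* [topologicalType] allows one canonical topology per type. To quantify over
   all topologies on a given group, a topology is a family of open sets, and
   [with_topology s] is a copy of the group whose canonical topology is [s]. *)
Record topology_on (T : Type) := TopologyOn {
  opens : set_system T ;
  opensT : opens setT ;
  opensI : setI_closed opens ;
  opens_bigcup : forall F : set_system T,
    F `<=` opens -> opens (\bigcup_(A in F) A)
}.

Definition with_topology (G : zmodType) (s : topology_on G) : Type := G.

Section WithTopology.
Variables (G : zmodType) (s : topology_on G).

Let opens_bigU (I : Type) (f : I -> set (with_topology s)) :
  (forall i, opens s (f i)) -> opens s (\bigcup_i f i).
Proof.
move=> sf; have := @opens_bigcup _ s (range f).
rewrite bigcup_image; apply=> _ [i _ <-]; exact: sf.
Qed.

HB.instance Definition _ := GRing.Zmodule.on (with_topology s).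
HB.instance Definition _ := isOpenTopological.Build (with_topology s)
  (@opensT _ s) (@opensI _ s) opens_bigU.

Definition hausdorff_group_topology : Prop :=
  [/\ continuous (fun xy : with_topology s * with_topology s => xy.1 + xy.2),
      continuous (fun x : with_topology s => - x)
    & hausdorff_space (with_topology s)].

End WithTopology.

Definition minimal (G : topologicalZmodType) : Prop :=
  hausdorff_space G /\
  ~ exists s : topology_on G, hausdorff_group_topology s /\ opens s `<` open.

Definition locally_minimal (G : topologicalZmodType) : Prop :=
  hausdorff_space G /\
  exists V : set G, nbhs (0 : G) V /\
    forall s : topology_on G, hausdorff_group_topology s ->
      opens s `<=` open -> nbhs (0 : with_topology s) V -> opens s = open.

Definition torsion_free (G : zmodType) : Prop :=
  forall (x : G) (n : nat), (0 < n)%N -> x *+ n = 0 -> x = 0.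

Definition subgroup (K : zmodType) (G : zmodClosed K) : Type :=
  {x : K | x \in G}.

HB.instance Definition _ (K : zmodType) (G : zmodClosed K) :=
  SubChoice.on (subgroup G).
HB.instance Definition _ (K : zmodType) (G : zmodClosed K) :=
  [SubChoice_isSubZmodule of subgroup G by <:].

Section SubgroupTopology.
Variables (K : topologicalZmodType) (G : zmodClosed K).

HB.instance Definition _ := Topological.copy (subgroup G)
  (initial_topology (val : subgroup G -> K)).

Let val_continuous : continuous (val : subgroup G -> K).
Proof. exact: initial_continuous. Qed.

Let subgroup_sub_continuous :
  continuous (fun xy : subgroup G * subgroup G => xy.1 - xy.2).
Proof.
apply/(@continuous_comp_initial (subgroup G) _ K val) => xy.
apply: (@continuous_comp _ _ _
  (fun xy : subgroup G * subgroup G => (val xy.1, val xy.2))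
  (fun uv : K * K => uv.1 - uv.2)); last exact: sub_continuous.
apply: cvg_pair.
- by apply: continuous_comp; [exact: cvg_fst | exact: val_continuous].
- by apply: continuous_comp; [exact: cvg_snd | exact: val_continuous].
Qed.

HB.instance Definition _ := PreTopologicalNmodule_isTopologicalZmodule.Build
  (subgroup G) subgroup_sub_continuous.

End SubgroupTopology.

(* Main.v *)
(**
Let s be a Hausdorff group topology on G coarser than the induced one, and let
N be the intersection of the closures in K of the s-neighbourhoods of 0: a
closed subgroup of K meeting G trivially. If N = 0, compactness of K makes s
the induced topology. Otherwise, K being torsion-free, every neighbourhood W of
0 in K contains a nonzero closed subgroup M of N; but for small W local
minimality applies to the topology that G inherits from K / M, which then
coincides with the induced one, although it cannot as M lies in the closure of
G.

That a nonzero closed subgroup N of K has small subgroups is shown without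
duality. If it has none, doubling is positively expansive on N at 0; as it is
injective on N, there is a neighbourhood D of 0 containing y in N as soon as it
contains 2y, and in which only 0 stays under all doublings. By recurrence, for
x in N nonzero and every j some b 2^j x with 0 < b <= r lies in D, hence so
does b 2^i x for all i <= j; by pigeonhole some b works for all i, so b x = 0.
*)
Require Import Defs.
From HB Require Import structures.
From mathcomp Require Import all_boot all_order all_algebra.
From mathcomp Require Import all_classical topology tvs.
From mathcomp Require Import zify.

Set Implicit Arguments.
Unset Strict Implicit.
Unset Printing Implicit Defensive.

Import GRing.Theory.
Local Open Scope classical_set_scope.
Local Open Scope ring_scope.

(** A point outside [O] is missed by some [C n], hence, on a neighbourhood of it, by all later ones;
    near [O] there is nothing to avoid. Compactness makes [n] uniform. *)
Lemma compact_decreasing_closed_sub_open (T : topologicalType)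
    (C : nat -> set T) (O : set T) :
  compact [set: T] -> (forall n, closed (C n)) ->
  (forall m n, (m <= n)%N -> C n `<=` C m) -> open O ->
  \bigcap_n C n `<=` O -> exists n, C n `<=` O.
Proof.
move=> /compact_near_coveringP cptT clC decC oO CO.
have [//|n _ nO] := cptT nat \oo (fun n x => C n x -> O x) _ _.
  move=> x _; have [Ox|nOx] := pselect (O x).
    exists (O, setT) => //=; last by move=> [y n] /= [].
    by split; [exact: open_nbhs_nbhs | exact: filterT].
  have /existsNP[n nCnx] : ~ (forall n, C n x) by move=> Cx; exact/nOx/CO.
  exists (~` C n, [set m | (n <= m)%N]) => /=.
    split; last by exists n.
    by apply: open_nbhs_nbhs; split => //; exact: closed_openC.
  by move=> [y m] /= [nCny /decC nm] /nm.
by exists n => x; apply: (nO n) => /=.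
Qed.

(** * Neighbourhoods of 0, multiples and subgroups in a topological abelian group *)

Section TopologicalGroup.
Variable K : topologicalZmodType.
Implicit Types (x y a : K) (A B C U W N : set K).

Lemma addr_continuous a : continuous (fun x => a + x).
Proof.
move=> x; apply: (@continuous_comp _ _ _ (fun x => (a, x))
  (fun z : K * K => z.1 + z.2)); last exact: add_continuous.
by apply: cvg_pair; [exact: cvg_cst | exact: cvg_id].
Qed.

Lemma mulrn_continuous n : continuous (fun x : K => x *+ n).
Proof.
elim: n => [|n IHn] x; first exact: cvg_cst.
rewrite /continuous_at mulrS.
under eq_fun do rewrite mulrS.
apply: (@continuous_comp _ _ _ (fun x : K => (x, x *+ n))
  (fun z : K * K => z.1 + z.2)); last exact: add_continuous.
by apply: cvg_pair; [exact: cvg_id | exact: IHn].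
Qed.

Lemma nbhs_translate x A : nbhs x A <-> nbhs (0 : K) [set y | A (x + y)].
Proof.
split=> [xA|xA].
  by apply: (addr_continuous (a := x)); rewrite addr0.
have -> : A = [set y | [set z | A (x + z)] (- x + y)].
  by apply/seteqP; split => y /=; rewrite addrCA addrA addNr add0r // addNKr.
by apply: (addr_continuous (a := - x)); rewrite addNr.
Qed.

Lemma nbhs_subr x W : nbhs (0 : K) W -> nbhs x [set y | W (y - x)].
Proof.
move=> W0; apply/nbhs_translate; apply: filterS W0 => y /=.
by rewrite addrAC subrr add0r.
Qed.

Lemma nbhs_sub x y W : nbhs (x - y) W ->
  exists A B, [/\ nbhs x A, nbhs y B & forall a b, A a -> B b -> W (a - b)].
Proof.
move=> /(@sub_continuous K (x, y)) [[A B] [/= xA yB] AB].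
by exists A, B; split => // a b Aa Bb; exact: (AB (a, b)).
Qed.

Lemma nbhs0_sub W : nbhs (0 : K) W ->
  exists2 U, nbhs (0 : K) U & forall x y, U x -> U y -> W (x - y).
Proof.
rewrite -{1}(subrr (0 : K)) => /nbhs_sub[A [B [A0 B0 AB]]].
exists (A `&` B); first exact: filterI.
by move=> x y [Ax _] [_ By]; exact: AB.
Qed.

Lemma nbhs0_opp W : nbhs (0 : K) W -> nbhs (0 : K) [set x | W (- x)].
Proof. by rewrite -{1}oppr0 => W0; exact: (@opp_continuous K 0). Qed.

Lemma nbhs0_add W : nbhs (0 : K) W ->
  exists2 U, nbhs (0 : K) U & forall x y, U x -> U y -> W (x + y).
Proof.
move=> /nbhs0_sub[U U0 UW]; exists (U `&` [set x | U (- x)]).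
  by apply: filterI => //; exact: nbhs0_opp.
by move=> x y [Ux _] [_ Uy]; rewrite -[y]opprK; exact: UW.
Qed.

Lemma nbhs0_multiples W (f : nat -> nat) n : nbhs (0 : K) W ->
  nbhs (0 : K) [set x | forall i, (i <= n)%N -> W (x *+ f i)].
Proof.
move=> W0; have W0f i : nbhs (0 : K) [set x | W (x *+ f i)].
  by apply: (mulrn_continuous (n := f i)); rewrite mul0rn.
elim: n => [|n IHn].
  by apply: filterS (W0f 0%N) => x Wx i; rewrite leqn0 => /eqP ->.
apply: filterS2 IHn (W0f n.+1) => x IHn Wx i.
by rewrite leq_eqVlt => /predU1P[->//|]; exact: IHn.
Qed.

Lemma closure_sub A B C x y : (forall a b, A a -> B b -> C (a - b)) ->
  closure A x -> closure B y -> closure C (x - y).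
Proof.
move=> ABC clAx clBy W /nbhs_sub[U [V [xU yV UVW]]].
have [a [Aa Ua]] := clAx _ xU; have [b [Bb Vb]] := clBy _ yV.
by exists (a - b); split; [exact: ABC | exact: UVW].
Qed.

Definition is_subgroup N := N 0 /\ forall x y, N x -> N y -> N (x - y).

Lemma subgroup_opp N x : is_subgroup N -> N x -> N (- x).
Proof. by move=> [N0 NB] Nx; rewrite -sub0r; exact: NB. Qed.

Lemma subgroup_add N x y : is_subgroup N -> N x -> N y -> N (x + y).
Proof.
by move=> Ns Nx Ny; rewrite -[y]opprK; apply: Ns.2 => //; exact: subgroup_opp.
Qed.

Lemma subgroup_mulrn N x n : is_subgroup N -> N x -> N (x *+ n).
Proof.
move=> Ns Nx; elim: n => [|n IHn]; first exact: Ns.1.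
by rewrite mulrS; exact: subgroup_add.
Qed.

Lemma closure_subgroup N : is_subgroup N -> is_subgroup (closure N).
Proof.
move=> [N0 NB]; split; first exact: subset_closure.
by move=> x y; exact: closure_sub.
Qed.

Lemma cyclic_subgroup x :
  is_subgroup [set y | exists m n, y = x *+ m - x *+ n].
Proof.
split; first by exists 0%N, 0%N; rewrite subrr.
move=> _ _ [m [n ->]] [p [q ->]]; exists (m + q)%N, (n + p)%N.
by rewrite opprB addrACA -opprD -!mulrnDr.
Qed.

(** * Compact groups: recurrence and small subgroups *)

Section CompactHausdorff.
Hypotheses (hausdorffK : hausdorff_space K) (compactK : compact [set: K]).

Lemma nbhs_closed_sub x W : nbhs x W ->
  exists U, [/\ nbhs x U, closed U & U `<=` W].
Proof.
move=> /(compact_regular hausdorffK compactK (filterT)) [U xU UW].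
exists (closure U); split => //; last exact: closed_closure.
by apply: filterS xU; exact: subset_closure.
Qed.

Lemma closed_preimage_mulrn n A : closed A -> closed [set x | A (x *+ n)].
Proof. by apply: closed_comp => x _; exact: mulrn_continuous. Qed.

Lemma closed_multiples N A (f : nat -> nat) n : closed N -> closed A ->
  closed [set x | N x /\ forall i, (i <= n)%N -> A (x *+ f i)].
Proof.
move=> clN clA.
have -> : [set x | N x /\ forall i, (i <= n)%N -> A (x *+ f i)] =
    N `&` \bigcap_(i in [set i | (i <= n)%N]) [set x | A (x *+ f i)] by [].
apply: closedI => //; apply: closed_bigI => i _.
exact: closed_preimage_mulrn.
Qed.

(** The sets cut out by the first [n] conditions are closed and decrease to the set where all of
    them hold, so finitely many conditions suffice. *)
Lemma bounded_multiples_sub_open N A (f : nat -> nat) (O : set K) :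
  closed N -> closed A -> open O ->
  (forall x, N x -> (forall i, A (x *+ f i)) -> O x) ->
  exists n, forall x, N x -> (forall i, (i <= n)%N -> A (x *+ f i)) -> O x.
Proof.
move=> clN clA oO NAO.
pose C n := [set x | N x /\ forall i, (i <= n)%N -> A (x *+ f i)].
have [| | |n nO] := compact_decreasing_closed_sub_open (C := C) compactK _ _ oO.
- by move=> n; exact: closed_multiples.
- by move=> p q pq x [Nx xq]; split => // i ip; apply: xq; exact: leq_trans pq.
- move=> x xP; apply: NAO => [|i]; first by have [] := xP 0%N I.
  by have [_] := xP i I; apply.
- by exists n => x Nx xA; exact: nO.
Qed.

(* Let [n] be the first multiple of [x] outside [W], where [W + W] is inside
   [W'], and let [2 ^ k <= n < 2 ^ k.+1]. If [2 ^ k x] is so small that many of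
   its multiples lie in [W], then many multiples of [n x] lie in [W']; as [W']
   contains no subgroup of [N], this puts [n x] back in [W]. *)
Lemma no_small_subgroup_doubling N W : closed N -> is_subgroup N ->
  nbhs (0 : K) W -> (forall x, N x -> (forall n, W (x *+ n)) -> x = 0) ->
  exists U, [/\ nbhs (0 : K) U, closed U &
    forall x, N x -> (forall k, U (x *+ 2 ^ k)) -> x = 0].
Proof.
move=> clN Ns /nbhs_closed_sub[W' [W'0 clW' W'W]] smallW.
have [V V0 VV] := nbhs0_add W'0.
have [m mV] : exists m, forall x, N x ->
    (forall i, (i <= m)%N -> W' (x *+ i)) -> V° x.
  apply: (bounded_multiples_sub_open (f := id)) => //.
    exact: open_interior.
  move=> x Nx xW'; suff -> : x = 0 by [].
  by apply: smallW => // n; exact: W'W.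
(* [2 * m] bounds the quotient of [n.+1 * i] by [2 ^ k] below, as [i <= m] and [n.+1 < 2 ^ k.+1]. *)
have [U [U0 clU UV]] := nbhs_closed_sub (nbhs0_multiples id (2 * m)%N V0).
exists U; split => // x Nx Ux; apply: smallW => // n.
apply: W'W; rewrite -[x *+ n]addr0; apply: (VV); last exact: nbhs_singleton.
elim/ltn_ind: n => n; case: n => [_|n IHn]; first exact: nbhs_singleton.
apply: interior_subset; apply: mV; first exact: subgroup_mulrn.
move=> i im; rewrite -mulrnA.
have ltk := trunc_logP (isT : 1 < 2)%N (isT : 0 < n.+1)%N.
have gtk := trunc_log_ltn n.+1 (isT : 1 < 2)%N.
set k := trunc_log 2 n.+1 in ltk gtk.
have k0 : (0 < 2 ^ k)%N by rewrite expn_gt0.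
(* The quotient part is handled by [U]; the remainder is less than [2 ^ k <= n.+1], so the induction
   hypothesis applies. *)
rewrite (divn_eq (n.+1 * i) (2 ^ k)) mulrnDr mulnC mulrnA; apply: VV.
  apply: UV; first exact: Ux.
  rewrite -ltnS ltn_divLR //; rewrite expnS in gtk; nia.
by apply: IHn; apply: leq_trans ltk; rewrite ltn_mod.
Qed.

(** The multiples of [x] cluster somewhere, and the difference of two visits near a cluster point is
    a return near 0; compactness bounds the return time uniformly. *)
Lemma bounded_recurrence W : nbhs (0 : K) W ->
  exists r, forall x, exists b, [/\ (0 < b)%N, (b <= r)%N & W (x *+ b)].
Proof.
(* The points none of whose positive multiples enters [W°] form the empty set. Taking [S] skips the
   multiple 0, whence the bound [r.+1] below. *)
move=> W0; have [||||r rP] := @bounded_multiples_sub_open setT (~` W°) S set0.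
- exact: closedT.
- by apply: open_closedC; exact: open_interior.
- exact: open0.
- move=> x _ xW.
  have [c [_ cx]] :=
    compactK (fmap_proper_filter (fun n => x *+ n) eventually_filter) filterT.
  have [V V0 VW] := nbhs0_sub (nbhs_interior W0).
  have cV := nbhs_subr c V0.
  have visit n0 : exists2 n, (n0 <= n)%N & V (x *+ n - c).
    have tail : (x *+ n @[n --> \oo]) [set x *+ n | n in [set n | (n0 <= n)%N]].
      by exists n0 => // n n0n; exists n.
    by have [_ [[n n0n <-] Vn]] := cx _ _ tail cV; exists n.
  have [p _ Vp] := visit 0%N; have [q pq Vq] := visit p.+1.
  apply: (xW (q - p.+1)%N); rewrite -subSn // subSS mulrnBr ?(ltnW pq) //.
  suff -> : x *+ q - x *+ p = (x *+ q - c) - (x *+ p - c) by exact: VW.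
  by rewrite opprB addrA subrK.
- exists r.+1 => x; apply: contrapT => xP; apply: (rP x) => // i ir Wx.
  by apply: xP; exists i.+1; split => //; exact: interior_subset.
Qed.

Lemma exists_small_multiples N W : torsion_free K -> closed N ->
  is_subgroup N -> nbhs (0 : K) W -> (exists2 x, N x & x <> 0) ->
  exists x, [/\ N x, x <> 0 & forall n, W (x *+ n)].
Proof.
move=> tfK clN Ns W0 [x Nx x0]; apply: contrapT => smallW.
have [|U [U0 clU smallU]] := @no_small_subgroup_doubling N W clN Ns W0.
  move=> y Ny Wy; apply: contrapT => y0; apply: smallW.
  by exists y.
(* Injectivity of doubling enters here: if all doublings of [y *+ 2] stay in [U], then [y *+ 2 = 0],
   so [y = 0]. By compactness, [k] steps already force [y] into [U°]. *)
have [||||k kU] := @bounded_multiples_sub_open N U (fun i => 2 ^ i.+1)%N U°.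
- by [].
- by [].
- exact: open_interior.
- move=> y Ny Uy; suff -> : y = 0 by [].
  apply: (tfK y 2%N) => //; apply: smallU => [|i]; first exact: subgroup_mulrn.
  by rewrite -mulrnA -expnS.
pose D := [set y | forall i, (i <= k)%N -> U (y *+ 2 ^ i)].
have D0 : nbhs (0 : K) D by exact: (nbhs0_multiples (expn 2)).
(* One halving: [D (z *+ 2)] controls the doublings 1 to [k.+1] of [z], and [kU] supplies the
   missing one, [z] itself. *)
have D_half y i j : (i <= j)%N -> N y -> D (y *+ 2 ^ j) -> D (y *+ 2 ^ i).
  move=> ij Ny; rewrite -(subnK ij); elim: (j - i)%N => // d IHd Dy.
  apply: IHd; rewrite addSn expnS mulnC mulrnA in Dy.
  set z := y *+ _ in Dy *; have Nz : N z by exact: subgroup_mulrn.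
  case=> [|l] lk.
    rewrite mulr1n; apply: interior_subset; apply: kU => // l lk'.
    by rewrite expnS mulrnA; exact: Dy.
  by rewrite expnS mulrnA; apply: Dy; exact: ltnW.
have [r rD] := bounded_recurrence D0.
(* [f b] is a time at which [x *+ b], nonzero for [b > 0], has left [D]. *)
have /choice[f fP] : forall b, exists j, (0 < b)%N -> ~ D (x *+ b *+ 2 ^ j).
  move=> b; apply: contrapT => bD.
  have xbD j : (0 < b)%N /\ D (x *+ b *+ 2 ^ j).
    split; last by apply: contrapT => nD; apply: bD; exists j.
    by rewrite lt0n; apply: contra_notN bD => /eqP ->; exists 0%N.
  have [b0 _] := xbD 0%N.
  apply: x0; apply: (tfK x b) => //; apply: smallU => [|j].
    exact: subgroup_mulrn.
  by have [_ /(_ 0%N)] := xbD j; rewrite mulr1n; apply.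
(* Recurrence at a time beyond all [f b] with [b <= r]; [D_half] then goes back to [f b], a
   contradiction. *)
have [b [b0 br]] := rD (x *+ 2 ^ \max_(b < r.+1) f b).
rewrite -mulrnA mulnC mulrnA => bD; apply: (fP b b0).
have br1 : (b < r.+1)%N by [].
apply: D_half bD; last exact: subgroup_mulrn.
exact: (@leq_bigmax _ (fun b : 'I_r.+1 => f b) (Ordinal br1)).
Qed.

End CompactHausdorff.
End TopologicalGroup.

(** * The induced topology on [G] and those coming from quotients of [K] *)

Section SubgroupTopologies.
Variables (K : topologicalZmodType) (G : zmodClosed K).
Local Notation H := (subgroup G).

Lemma nbhs_subgroup (a : H) (A : set H) : nbhs a A <->
  exists2 O, nbhs (0 : K) O & [set g : H | O (val g - val a)] `<=` A.
Proof.
split=> [[_ [[O oO <-] Oa] OA]|[O O0 OA]].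
  exists [set x | O (val a + x)].
    by apply: (nbhs_translate _ _).1; apply: open_nbhs_nbhs; split.
  by move=> g /=; rewrite addrC subrK => /OA.
apply: (filterS OA).
apply: (@initial_continuous H K val a [set x | O (x - val a)]).
exact: nbhs_subr.
Qed.

Section QuotientTopology.
Variable M : set K.

(** The trace on [G] of [a + O + M], that is, of a neighbourhood of the coset of [a] in [K / M]. *)
Definition coset_nbhd (O : set K) (a : H) : set H :=
  [set g | exists2 m, M m & O (val g - val a - m)].

Definition quotient_opens : set_system H :=
  [set A | forall a, A a -> exists2 O, nbhs (0 : K) O & coset_nbhd O a `<=` A].

Let quotient_opensT : quotient_opens setT.
Proof. by move=> a _; exists setT => //; exact: filterT. Qed.

Let quotient_opensI : setI_closed quotient_opens.
Proof.
move=> A B oA oB a [/oA[O O0 OA] /oB[P P0 PB]].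
exists (O `&` P); first exact: filterI.
move=> g [m Mm [Om Pm]].
by split; [apply: OA; exists m | apply: PB; exists m].
Qed.

Let quotient_opens_bigcup (F : set_system H) :
  F `<=` quotient_opens -> quotient_opens (\bigcup_(A in F) A).
Proof.
move=> oF a [A FA Aa]; have [O O0 OA] := oF A FA a Aa.
by exists O => // g /OA Ag; exists A.
Qed.

(* The topology of the image of [G] in the quotient group [K / M]; it separates
   points only if [G] meets [M] trivially. *)
Definition quotient_topology_on : topology_on H :=
  TopologyOn quotient_opensT quotient_opensI quotient_opens_bigcup.

Hypothesis M_subgroup : is_subgroup M.

Lemma nbhs_quotient_topology_on (a : H) (A : set H) :
  nbhs (a : with_topology quotient_topology_on) A <->
  exists2 O, nbhs (0 : K) O & coset_nbhd O a `<=` A.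
Proof.
split=> [[B [oB Ba BA]]|[O O0 OA]].
  by have [O O0 OB] := oB a Ba; exists O => //; exact: subset_trans BA.
(* Passing to the interior makes this set open: sums of elements of [M] stay in [M]. *)
exists (coset_nbhd O° a); split.
- move=> g [m Mm Og]; exists [set x | O° (val g - val a - m + x)].
    apply: (nbhs_translate _ _).1; apply: open_nbhs_nbhs; split => //.
    exact: open_interior.
  move=> h [m' Mm' /=].
  have -> : val g - val a - m + (val h - val g - m') = val h - val a - (m + m').
    by rewrite addrACA -opprD [val g - _ + _]addrC addrA subrK.
  by exists (m + m') => //; exact: subgroup_add.
- exists 0; first exact: M_subgroup.1.
  by rewrite subrr subr0; exact: nbhs_singleton (nbhs_interior O0).
- apply: subset_trans OA => g [m Mm Og]; exists m => //.
  exact: interior_subset.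
Qed.

Lemma quotient_topology_on_coarser : opens quotient_topology_on `<=` open.
Proof.
move=> A oA; rewrite openE => a /oA[O O0 OA].
apply/nbhs_subgroup; exists O => // g Og; apply: OA; exists 0.
  exact: M_subgroup.1.
by rewrite subr0.
Qed.

Lemma quotient_topology_on_hausdorff_group : closed M ->
  (forall g : H, M (val g) -> g = 0) ->
  hausdorff_group_topology quotient_topology_on.
Proof.
move=> clM MG; split.
- move=> [a b] A /= /nbhs_quotient_topology_on[O O0 OA].
  have [V V0 VO] := nbhs0_add O0.
  exists (coset_nbhd V a, coset_nbhd V b) => /=.
    by split; apply/nbhs_quotient_topology_on; exists V.
  move=> [g h] /= [[m Mm Vm] [n Mn Vn]]; apply: OA.
  exists (m + n); first exact: subgroup_add.
  suff -> : val (g + h) - val (a + b) - (m + n) =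
    (val g - val a - m) + (val h - val b - n) by exact: VO.
  rewrite -[LHS]/(val g + val h - (val a + val b) - (m + n)).
  by rewrite !opprD [RHS]addrACA; congr (_ + _); rewrite addrACA.
- move=> a A /= /nbhs_quotient_topology_on[O O0 OA].
  apply/nbhs_quotient_topology_on; exists [set x | O (- x)].
    exact: nbhs0_opp.
  move=> g [m Mm Om]; apply: OA; exists (- m); first exact: subgroup_opp.
  suff -> : val (- g) - val (- a) - - m = - (val g - val a - m) by [].
  by rewrite -[LHS]/(- val g - - val a - - m) !opprD.
(* Inseparable points [a] and [b] have [a - b] in the closure of [M]: a common point [g] puts
   [n - m] in [a - b + (V - V)]. *)
- move=> a b ab; apply/eqP; rewrite -subr_eq0; apply/eqP/MG.
  have -> : M = closure M by apply/closure_id.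
  move=> W /(nbhs_translate _ _).1 /nbhs0_sub[V V0 VW].
  have [||g [[m Mm Vm] [n Mn Vn]]] := ab (coset_nbhd V a) (coset_nbhd V b).
  + by apply/nbhs_quotient_topology_on; exists V.
  + by apply/nbhs_quotient_topology_on; exists V.
  exists (n - m); split; first exact: M_subgroup.2.
  suff -> : n - m = val (a - b) + ((val g - val a - m) - (val g - val b - n)).
    exact: VW.
  have E : val g - val a + (val b - val g) = val b - val a.
    by rewrite addrC addrA subrK.
  rewrite -[val (a - b)]/(val a - val b) opprB [n - (_ - _)]addrC opprB.
  rewrite [X in _ = _ + X]addrACA.
  by rewrite E [RHS]addrA [val a - _ + _]addrA subrK subrr add0r addrC.
Qed.

End QuotientTopology.

(** With [W + W] inside [O], the set [V] is a neighbourhood of 0 modulo [M], so the quotient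
    topology is the induced one. Points of [G] near [x] in [M] are near 0 modulo [M], hence near 0
    in [K]. *)
Lemma locally_minimal_meets_small_subgroups :
  hausdorff_space K -> compact [set: K] -> locally_minimal H ->
  exists2 W, nbhs (0 : K) W & forall M, closed M -> is_subgroup M ->
    M `<=` closure [set x | x \in G] -> M `<=` W ->
    (forall g : H, M (val g) -> g = 0) -> forall x, M x -> x = 0.
Proof.
move=> hK cK [_ [V [/nbhs_subgroup[O O0 OV] minV]]].
have [W W0 WO] := nbhs0_add O0.
exists W => // M clM Ms MG MW trivM x Mx.
have sE : opens (quotient_topology_on M) = open.
  apply: minV.
  - exact: quotient_topology_on_hausdorff_group.
  - exact: quotient_topology_on_coarser.
  - apply/(nbhs_quotient_topology_on Ms); exists W => // g [m Mm Wm].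
    apply: OV => /=; rewrite -(subrK m (val g - _)).
    by apply: WO => //; exact: MW.
apply: (hK) => A B xA /(nbhs_closed_sub hK cK)[C [C0 clC CB]].
exists x; split; first exact: nbhs_singleton.
apply/CB/clC => D xD.
have : nbhs (0 : H) [set g | C (val g)].
  by apply/nbhs_subgroup; exists C => // g /=; rewrite subr0.
rewrite nbhsE => -[E [+ E0] EC].
rewrite -[open E]/((open : set_system H) E) -sE => oE.
have [P P0 PE] : exists2 P, nbhs (0 : K) P & coset_nbhd M P 0 `<=` E.
  by apply/(nbhs_quotient_topology_on Ms); exists E; split.
have [z [Gz [Dz Pz]]] := MG _ Mx _ (filterI xD (nbhs_subr x P0)).
exists z; split => //; apply: (EC (Sub z Gz)); apply: PE.
by exists x => //=; rewrite subr0.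
Qed.

End SubgroupTopologies.

(** Makes the general lemmas on topological groups available for [s]. *)
Definition topologicalZmod_of (G : zmodType) (s : topology_on G)
    (addC : continuous
      (fun xy : with_topology s * with_topology s => xy.1 + xy.2))
    (oppC : continuous (fun x : with_topology s => - x)) :
    topologicalZmodType :=
  HB.pack (with_topology s)
    (PreTopologicalNmodule_isTopologicalNmodule.Build (with_topology s) addC)
    (TopologicalNmodule_isTopologicalZmodule.Build (with_topology s) oppC).

(** * Comparing a coarser Hausdorff group topology with the induced one *)

Section CoarserTopology.
Variables (K : topologicalZmodType) (G : zmodClosed K).
Local Notation H := (subgroup G).
Variable s : topology_on H.
Hypothesis group_s : hausdorff_group_topology s.
Hypothesis coarser_s : opens s `<=` open.
Local Notation Hs := (with_topology s).

(* The kernel of the extension of the identity of [G] to a map from the closure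
   of [G] in [K] to the completion of [G] for [s]. *)
Definition cluster0 : set K := cluster ((val : H -> K) @ nbhs (0 : Hs)).

Lemma cluster0_closed : closed cluster0.
Proof.
rewrite /cluster0 clusterE; apply: closed_bigI => A _; exact: closed_closure.
Qed.

Lemma cluster0_sub_closure : cluster0 `<=` closure [set x | x \in G].
Proof.
move=> x xc A; apply: xc.
by apply: (@filterE _ (nbhs (0 : Hs))) => g; exact: (valP g).
Qed.

Lemma cluster0_subgroup : is_subgroup cluster0.
Proof.
case: (group_s) => addC oppC _; split.
  move=> A B A0 B0; exists 0; split; last exact: nbhs_singleton.
  exact: (nbhs_singleton (A0 : nbhs (0 : Hs) (val @^-1` A))).
move=> x y xc yc A B /= A0 Bxy.
have [V V0 VA] := @nbhs0_sub (topologicalZmod_of addC oppC) _ A0.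
have clV z : cluster0 z -> closure [set val g | g in (V : set H)] z.
  move=> zc C zC; apply: zc zC => /=; apply: filterS V0 => g Vg.
  by exists g.
apply: (closure_sub _ (clV _ xc) (clV _ yc)) Bxy.
by move=> _ _ [g Vg <-] [h Vh <-]; exact: (VA _ _ Vg Vh).
Qed.

(** An [s]-neighbourhood of [g] is also one for the induced topology, so it meets every
    [s]-neighbourhood of 0; and [s] is Hausdorff. *)
Lemma cluster0_val (g : H) : cluster0 (val g) -> g = 0.
Proof.
move=> gc; case: (group_s) => _ _ hs; apply: (hs g 0) => A B gA B0.
have /nbhs_subgroup[O O0 OA] : nbhs (g : H) A.
  case: gA => C [oC Cg CA]; apply: (filterS CA).
  by apply: open_nbhs_nbhs; split => //; exact: coarser_s.
have Bg : (val @ nbhs (0 : Hs)) [set val h | h in (B : set H)].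
  by apply: filterS B0 => h Bh; exists h.
have [_ [[h Bh <-] Oh]] := gc _ _ Bg (nbhs_subr _ O0).
by exists h; split => //; exact: OA.
Qed.

(** In a compact Hausdorff space a filter with a single cluster point converges to it; so every
    induced neighbourhood of 0 is an [s]-neighbourhood. *)
Lemma cluster0_trivial_open_sub : hausdorff_space K -> compact [set: K] ->
  cluster0 = [set 0] -> open `<=` opens s.
Proof.
move=> hK cK c0 A oA; have {}oA (a : H) : A a -> nbhs a A.
  by move=> Aa; apply: open_nbhs_nbhs.
case: (group_s) => addC oppC _.
change (open (A : set (topologicalZmod_of addC oppC))).
rewrite openE => a /oA /nbhs_subgroup[O O0 OA].
apply: (@nbhs_translate (topologicalZmod_of addC oppC) a A).2.
have O_s : nbhs (0 : Hs) ((val : H -> K) @^-1` O).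
  exact: (compact_cluster_set1 hK cK filterT _ filterT c0 O0).
apply: filterS O_s => g Og; apply: OA => /=.
suff -> : val (a + g) - val a = val g by [].
by rewrite -[LHS]/(val a + val g - val a) addrAC subrr add0r.
Qed.

End CoarserTopology.

Theorem corollary4p7 (K : topologicalZmodType) (G : zmodClosed K)
    (hausdorffK : hausdorff_space K) (compactK : compact [set: K])
    (torsion_freeK : torsion_free K) :
  locally_minimal (subgroup G) <-> minimal (subgroup G).
Proof.
split=> [lmG|[hG minG]]; last first.
  split => //; exists setT; split; first exact: filterT.
  move=> s gs sG _; apply/seteqP; split => //; apply: contrapT => Gs.
  by apply: minG; exists s.
split; first by case: lmG.
move=> [s [gs [sG]]]; apply.
have [W W0 small] :=
  locally_minimal_meets_small_subgroups hausdorffK compactK lmG.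
apply: cluster0_trivial_open_sub => //; apply/seteqP; split; last first.
  by move=> _ ->; exact: (cluster0_subgroup gs).1.
move=> x xc; apply: contrapT => /= x0.
have [U [U0 clU UW]] := nbhs_closed_sub hausdorffK compactK W0.
have [V V0 VU] := nbhs0_sub U0.
have cs := cluster0_subgroup gs.
have [|y [yc y0 Vy]] := exists_small_multiples hausdorffK compactK torsion_freeK
  (@cluster0_closed _ _ s) cs V0.
  by exists x.
(* The small subgroup is the closure of [Z]: multiples of [y] lie in [V], their differences in [U],
   and [U] is closed. *)
pose Z := [set z | exists m n, z = y *+ m - y *+ n].
have Zc : closure Z `<=` cluster0 s.
  rewrite [X in _ `<=` X]((closure_id _).1 (@cluster0_closed _ _ s)).
  apply: closureS => _ [m [n ->]].
  by apply: cs.2; exact: (subgroup_mulrn _ cs yc).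
apply: y0; apply: (small (closure Z)).
- exact: closed_closure.
- by apply: closure_subgroup; exact: cyclic_subgroup.
- by move=> z /Zc /cluster0_sub_closure.
- apply: subset_trans UW; rewrite [X in _ `<=` X]((closure_id _).1 clU).
  by apply: closureS => _ [m [n ->]]; exact: VU.
- by move=> g /Zc /(cluster0_val gs sG).
- by apply: subset_closure; exists 1%N, 0%N; rewrite subr0.
Qed.
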